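(* Let $n>1$ be odd and let $f$ be drawn uniformly at random from $\mathcal{S}_n$. Then \[ \mathbb{E}\big(\|f\|_4^4\big)=2n^2-3n+2, \] \[ {\rm Var}\big(\|f\|_4^4\big)=\frac{32}{3}n^3-88n^2+\frac{592}{3}n-512\left\lfloor\frac{n-1}{8}\right\rfloor-512\left\lfloor\frac{n-1}{12}\right\rfloor-88+16(-1)^{\frac{n-1}{2}}(n-3). \]
   Context: For a polynomial $f\in\mathbb{C}[z]$ and real $p>0$, $\|f\|_p=\big(\frac{1}{2\pi}\int_0^{2\pi}|f(e^{i\theta})|^p\,d\theta\big)^{1/p}$. For an integer $n>1$, $\mathcal{L}_n$ is the set of polynomials $\sum_{j=0}^{n-1}a_jz^j$ with all $a_j\in\{1,-1\}$. The skew-symmetric Littlewood polynomials are $\mathcal{S}_n=\{f\in\mathcal{L}_n: n \text{ odd and } f(z)=(-1)^{\frac{n-1}{2}}z^{n-1}f(-z^{-1})\}$. *)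

(* Defs.v *)
From HB Require Import structures.
From mathcomp Require Import all_boot all_order all_algebra finmap.
From mathcomp Require Import complex.
From mathcomp Require Import all_classical all_reals all_analysis.

Set Implicit Arguments.
Unset Strict Implicit.
Unset Printing Implicit Defensive.

Import Order.TTheory GRing.Theory Num.Theory.

Local Open Scope classical_set_scope.
Local Open Scope ring_scope.

Definition expi (R : realType) (t : R) : R[i] := Complex (cos t) (sin t).

(* Real-valued modulus; [`|z|] itself lives in [R[i]]. *)
Definition modulus (R : realType) (z : R[i]) : R := complex.Re `|z|.

Definition polynorm (R : realType) (p : R) (f : {poly R[i]}) : R :=
  ((2 * pi)^-1 *
     \int[@lebesgue_measure R]_(t in `[0, 2 * pi])
        (modulus f.[expi t] `^ p)) `^ p^-1.

Definition littlewood (R : realType) (n : nat) : set {poly R[i]} :=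
  [set f | exists a : nat -> R[i],
     (forall j, (j < n)%N -> a j = 1 \/ a j = -1) /\
     f = \poly_(j < n) a j].
Arguments littlewood : clear implicits.

(* The functional equation is an identity of Laurent polynomials, hence it is
   required only at [z != 0] (where [z^-1] is the true inverse). *)
Definition skew_littlewood (R : realType) (n : nat) : set {poly R[i]} :=
  [set f | littlewood R n f /\ odd n /\
     forall z : R[i], z != 0 ->
       f.[z] = (-1) ^+ n.-1./2 * z ^+ n.-1 * f.[- z^-1]].
Arguments skew_littlewood : clear implicits.

(* [F] lies in [S] everywhere, not just almost surely, so that every function
   of [F] is measurable although [V] carries no sigma-algebra. *)
Definition uniform_on d (T : measurableType d) (R : realType)
    (P : probability T R) (V : choiceType) (S : set V) (F : T -> V) : Prop :=
  [/\ finite_set S,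
      forall w, S (F w) &
      forall v, S v ->
        measurable (F @^-1` [set v]) /\
        P (F @^-1` [set v]) = ((#|` fset_set S|%fset)%:R^-1)%:E].

Lemma finite_littlewood (R : realType) (n : nat) :
  finite_set (littlewood R n).
Proof.
apply: (@sub_finite_set _ _
  ((fun b : {ffun 'I_n -> bool} =>
      \poly_(j < n) (-1) ^+ (if insub j is Some i then b i else false))
   @` setT)); last exact/finite_image/finite_finset.
move=> f [a [a1 ->]]; exists [ffun i : 'I_n => a i == -1] => //.
apply/polyP => j; rewrite !coef_poly; case: ltnP => // jn.
rewrite insubT ffunE /=.
by case: (a1 j jn) => ->; rewrite ?eqxx ?expr1// -subr_eq0 opprK -[1 + 1]/(2%:R) pnatr_eq0.
Qed.

Lemma finite_skew_littlewood (R : realType) (n : nat) :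
  finite_set (skew_littlewood R n).
Proof. by apply: sub_finite_set (finite_littlewood R n) => f []. Qed.

(* Main.v *)
Require Import Defs.
From HB Require Import structures.
From mathcomp Require Import all_boot all_order all_algebra finmap.
From mathcomp Require Import complex zify ring lra.
From mathcomp Require Import all_classical all_reals all_analysis.

Set Implicit Arguments.
Unset Strict Implicit.
Unset Printing Implicit Defensive.

Import Order.TTheory GRing.Theory Num.Theory numFieldNormedType.Exports.

Local Open Scope classical_set_scope.
Local Open Scope ring_scope.

(** Write n = 2m+1 and b_k = a_{m+k}.  Skew-symmetry reads b_{-k} = (-1)^k b_k, so
    x_0, ..., x_m with x_k = b_k are independent signs; the odd aperiodic autocorrelations
    vanish and ||f||_4^4 = n^2 + 2 sum_v C_{2v}^2.  Passing from m-1 to m appends one term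
    b_{m-2v} b_m at both ends of C_{2v}, hence

      ||f||_4^4 = 2n^2 - 3n + 2 + 8 sum_{1<=t<=m} x_t L_t,
      L_t = sum_v b_{t-2v} C_{2v}^{(t-1)},

    with L_t depending on x_0, ..., x_{t-1} only.  The summands are centred and pairwise
    orthogonal, so the variance is 64 sum_t E[L_t^2].  Splitting the sum C_{2v}^{(t-1)}
    according to the parity of its index, one part of L_t becomes
    (-1)^t sum_{u+v+w=t} b_{t-2u} b_{t-2v} b_{t-2w} over compositions of t, and the other
    a sum of monomials with indices of mixed parity.  After collecting equal monomials,
    Parseval gives E[L_t^2] as a count: L_t = 6 (strict compositions) + 2 (mixed triples)
    + (linear terms), and the floors in the variance come from the compositions of t with
    three equal parts and from the term v = t/2. *)

(** * Skew-symmetric sign sequences *)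

Lemma sum_odd_even (V : nmodType) (F : nat -> V) (k : nat) :
  \sum_(j < k.*2.+1) F j = \sum_(i < k) F i.*2.+1 + \sum_(i < k.+1) F i.*2.
Proof.
elim: k => [|k IH]; first by rewrite /= big_ord0 add0r !big_ord1.
rewrite doubleS 2!big_ord_recr /= IH [in RHS]big_ord_recr /=.
rewrite [X in _ = _ + X]big_ord_recr /= doubleS.
by rewrite -!addrA; congr (_ + _); rewrite addrCA.
Qed.

(* The coefficients [b_z = a_(m + z)] as a function of [x_k = b_k], [k >= 0]. *)
Definition skew_ext (R : realFieldType) (x : nat -> R) (z : int) : R :=
  if z is Posz k then x k else (-1) ^+ `|z|%N * x `|z|%N.

Section SkewExt.
Variables (R : realFieldType) (x : nat -> R).
Hypothesis x2 : forall k, x k * x k = 1.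
Local Notation b := (skew_ext x).

Lemma sign_sq k : (-1) ^+ k * (-1) ^+ k = 1 :> R.
Proof. by rewrite -expr2 sqrr_sign. Qed.

Lemma skew_extN z : b (- z) = (-1) ^+ `|z|%N * b z.
Proof.
case: z => [[|k]|k] //=; first by rewrite mul1r.
by rewrite mulrA sign_sq mul1r.
Qed.

Lemma skew_ext_sq z : b z * b z = 1.
Proof. by case: z => k //=; rewrite mulrACA sign_sq x2 mul1r. Qed.

(* The autocorrelation at the even shift [2 v], for length [2 m + 1]. *)
Definition autocor (m v : nat) : R :=
  \sum_(j < (m - v).*2.+1) b (j%:Z - m%:Z) * b (j%:Z - m%:Z + v.*2%:Z).

(** Two end terms are new, [b (-(m+1)) b (2v-m-1)] and [b (m+1-2v) b (m+1)]. Skew-symmetry makes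
    them equal, since [m+1] and [m+1-2v] have the same parity. *)
Lemma autocor_rec m v : (v <= m)%N ->
  autocor m.+1 v = autocor m v + 2 * b (m.+1%:Z - v.*2%:Z) * x m.+1.
Proof.
move=> vm; rewrite /autocor subSn // doubleS big_ord_recr big_ord_recl /=.
have -> : 0 - m.+1%:Z = - m.+1%:Z by lia.
have -> : - m.+1%:Z + v.*2%:Z = - (m.+1%:Z - v.*2%:Z) by lia.
have -> : (m - v).*2.+2%:Z - m.+1%:Z = m.+1%:Z - v.*2%:Z by lia.
have -> : m.+1%:Z - v.*2%:Z + v.*2%:Z = m.+1%:Z by lia.
rewrite !skew_extN ?subn0.
have -> : \sum_(i < (m - v).*2.+1) b ((bump 0 i)%:Z - m.+1%:Z)
    * b ((bump 0 i)%:Z - m.+1%:Z + v.*2%:Z) =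
  \sum_(j < (m - v).*2.+1) b (j%:Z - m%:Z) * b (j%:Z - m%:Z + v.*2%:Z).
  by apply: eq_bigr => i _; congr (b _ * b _); rewrite /bump /=; lia.
have -> : (-1) ^+ `|m.+1%:Z - v.*2%:Z|%N = (-1) ^+ m.+1 :> R.
  by rewrite -signr_odd -[RHS]signr_odd; congr (_ ^+ _); lia.
rewrite /= ?subn0; have := sign_sq m.+1.
set s := _ ^+ _; set S := \sum_(_ < _) _ => ss.
rewrite [X in X + _](_ : _ = (s * s) * (x m.+1 * b (m.+1%:Z - v.*2%:Z)) + S); last by ring.
rewrite ss; ring.
Qed.

Lemma autocor_diag m : autocor m m = (-1) ^+ m.
Proof.
rewrite /autocor subnn big_ord_recl big_ord0 addr0 /=.
have -> : 0 - m%:Z = - m%:Z by lia.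
have -> : - m%:Z + m.*2%:Z = m%:Z by lia.
by rewrite skew_extN /= -mulrA x2 mulr1.
Qed.

(** Reversing the order of summation negates both indices and swaps the factors. The shift is odd,
    so the two skew signs multiply to -1 and the sum equals its own negative. *)
Lemma odd_autocor0 m v : (v < m)%N ->
  \sum_(j < m.*2.+1 - v.*2.+1) b (j%:Z - m%:Z) * b ((j + v.*2.+1)%:Z - m%:Z) = 0.
Proof.
move=> vm; set S := \sum_(_ < _) _.
suff : S = - S by move=> SS; lra.
rewrite -sumrN /S (reindex_inj rev_ord_inj) /=; apply: eq_bigr => j _.
have jl := ltn_ord j.
have -> : (m.*2.+1 - v.*2.+1 - j.+1)%:Z - m%:Z = - ((j + v.*2.+1)%:Z - m%:Z) by lia.
have -> : (m.*2.+1 - v.*2.+1 - j.+1 + v.*2.+1)%:Z - m%:Z = - (j%:Z - m%:Z) by lia.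
rewrite !skew_extN ?subn0.
have -> : (-1) ^+ `|(j + v.*2.+1)%:Z - m%:Z|%N = - (-1) ^+ `|j%:Z - m%:Z|%N :> R.
  by rewrite -signr_odd -[in RHS]signr_odd -signrN; congr (_ ^+ _); lia.
have := sign_sq `|j%:Z - m%:Z|%N; set s := _ ^+ _ => ss.
rewrite mulrACA mulNr ss; ring.
Qed.

(* The increment of [norm44] from [t - 1] to [t] is [16 t - 6 + 8 x_t incr t]. *)
Definition incr (t : nat) : R :=
  \sum_(1 <= v < t) b (t%:Z - v.*2%:Z) * autocor t.-1 v.

(** The fourth power of the norm in terms of autocorrelations; [norm44_autocor] and [polynorm4_real]
    link it to the integral. *)
Definition norm44 (m : nat) : R :=
  m.*2.+1%:R ^+ 2 + 2 * \sum_(1 <= v < m.+1) autocor m v ^+ 2.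

Lemma norm44_incr m : norm44 m =
  2 * m.*2.+1%:R ^+ 2 - 3 * m.*2.+1%:R + 2 + 8 * \sum_(1 <= t < m.+1) x t * incr t.
Proof.
elim: m => [|m IH]; first by rewrite /norm44 !big_geq // double0; ring.
rewrite [in RHS]big_nat_recr //=.
(* The square of the length grows by [8m+8], the [m] old shifts contribute [2 * 4m] and the new
   shift [m+1] contributes 2; together [16(m+1) - 6]. *)
have -> : norm44 m.+1 = norm44 m + (16 * m.+1%:R - 6) + 8 * (x m.+1 * incr m.+1).
  rewrite /norm44 big_nat_recr //= autocor_diag -exprM mulnC exprM sqrrN !expr1n.
  rewrite /incr /= [x _ * _]mulr_sumr.
  have -> : \sum_(1 <= v < m.+1) autocor m.+1 v ^+ 2 =
    \sum_(1 <= v < m.+1) (autocor m v ^+ 2 + 4 + 4 * (x m.+1 * (b (m.+1%:Z - v.*2%:Z) * autocor m v))).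
    apply: eq_big_nat => v /andP[_ vm]; rewrite autocor_rec //.
    have := skew_ext_sq (m.+1%:Z - v.*2%:Z); have := x2 m.+1.
    set y := b _; set z := x _ => zz yy.
    rewrite (_ : _ ^+ 2 = autocor m v ^+ 2 + 4 * (y * y) * (z * z) + 4 * (z * (y * autocor m v))); last by ring.
    by rewrite zz yy; ring.
  rewrite !big_split /= sumr_const_nat -mulr_sumr subn1 /=.
  rewrite -[_ *+ m]mulr_natr -!muln2 -!(addn1 (_ * _)) !natrD !natrM -natr1; ring.
rewrite IH -!muln2 -!(addn1 (_ * _)) !natrD !natrM -(natr1 m). ring.
Qed.
End SkewExt.

(** The involution [i -> k - i] pairs the lower half with the upper half; its fixed point [k/2]
    exists only for even [k]. *)
Lemma sum_palindrome (V : nmodType) (F : nat -> V) (k : nat) :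
  (forall i, (i <= k)%N -> F (k - i)%N = F i) ->
  \sum_(i < k.+1) F i =
    (if odd k then 0 else F k./2) + (\sum_(i < k.+1 | (k < i.*2)%N) F i) *+ 2.
Proof.
move=> Fk; rewrite (bigID (fun i : 'I_k.+1 => (k < i.*2)%N)) /= mulr2n.
rewrite [in RHS]addrCA; congr (_ + _).
rewrite (bigID (fun i : 'I_k.+1 => i.*2 == k)) /=; congr (_ + _).
  case: ifP => ok.
    by rewrite big_pred0 // => i; apply/negbTE; lia.
  have kl : (k./2 < k.+1)%N by lia.
  rewrite (bigD1 (Ordinal kl)) /=; last by lia.
  by rewrite big1 ?addr0 // => i /andP[? /eqP]; case; apply: val_inj => /=; lia.
rewrite (reindex_inj rev_ord_inj) /=; apply: eq_big => i; last first.
  by move=> _; rewrite subSS Fk // -ltnS.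
by have := ltn_ord i; rewrite subSS; lia.
Qed.

(** * Symmetric sums over triples, and compositions *)

Section Compositions.
Variables (R : pzRingType) (n : nat) (H : nat -> nat -> nat -> R).
Hypothesis H12 : forall u v w, H u v w = H v u w.
Hypothesis H23 : forall u v w, H u v w = H u w v.

Let S (Q : nat -> nat -> nat -> bool) :=
  \sum_(u < n) \sum_(v < n) \sum_(w < n) H u v w *+ Q u v w.

(** Symmetry of [H] moves a transposition of the summation variables onto the constraint [Q]; the
    two adjacent transpositions reach every order. *)
Let S12 Q : S Q = S (fun u v w => Q v u w).
Proof.
rewrite /S exchange_big; do 3 (apply: eq_bigr => ? _).
by rewrite H12.
Qed.

Let S23 Q : S Q = S (fun u v w => Q u w v).
Proof.
apply: eq_bigr => u _; rewrite exchange_big; do 2 (apply: eq_bigr => ? _).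
by rewrite H23.
Qed.

(** Every triple falls under exactly one of ten patterns: six strict orders, three with exactly two
    equal entries, and the diagonal. Symmetry identifies patterns of the same kind. *)
Lemma sum3_symmetric :
  \sum_(u < n) \sum_(v < n) \sum_(w < n) H u v w =
  6 * (\sum_(u < n) \sum_(v < n) \sum_(w < n) H u v w *+ (u < v < w)%N) +
  3 * (\sum_(u < n) \sum_(v < n) H u v v *+ (u != v)) + \sum_(u < n) H u u u.
Proof.
have -> : \sum_(u < n) \sum_(v < n) \sum_(w < n) H u v w =
  S (fun u v w => u < v < w)%N + S (fun u v w => u < w < v)%N
  + S (fun u v w => v < u < w)%N + S (fun u v w => v < w < u)%N
  + S (fun u v w => w < u < v)%N + S (fun u v w => w < v < u)%N
  + (S (fun u v w => (v == w) && (u != v)) + S (fun u v w => (w == u) && (v != w))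
  + S (fun u v w => (u == v) && (w != u))) + S (fun u v w => (u == v) && (v == w)).
  rewrite /S -!big_split; apply: eq_bigr => u _.
  rewrite -!big_split; apply: eq_bigr => v _.
  rewrite -!big_split; apply: eq_bigr => w _.
  rewrite /= -!mulrnDr.
  by rewrite (_ : (_ + _)%N = 1%N) //; lia.
have -> : S (fun u v w => u < w < v)%N = S (fun u v w => u < v < w)%N by rewrite S23.
have -> : S (fun u v w => v < u < w)%N = S (fun u v w => u < v < w)%N by rewrite S12.
have -> : S (fun u v w => v < w < u)%N = S (fun u v w => u < v < w)%N by rewrite S12 S23.
have -> : S (fun u v w => w < u < v)%N = S (fun u v w => u < v < w)%N by rewrite S23 S12.
have -> : S (fun u v w => w < v < u)%N = S (fun u v w => u < v < w)%N by rewrite S23 S12 S23.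
have -> : S (fun u v w => (w == u) && (v != w)) = S (fun u v w => (v == w) && (u != v)).
  rewrite S12; do 3 (apply: eq_bigr => ? _); congr (_ *+ _); lia.
have -> : S (fun u v w => (u == v) && (w != u)) = S (fun u v w => (v == w) && (u != v)).
  rewrite S23 S12 S23; do 3 (apply: eq_bigr => ? _); congr (_ *+ _); lia.
have -> : S (fun u v w => (v == w) && (u != v)) = \sum_(u < n) \sum_(v < n) H u v v *+ (u != v).
  apply: eq_bigr => u _; apply: eq_bigr => v _.
  rewrite (bigD1 v) //= eqxx /= big1 ?addr0; last first.
    by move=> w; rewrite eq_sym => /negbTE vw; rewrite (_ : _ == _ = false).
  by [].
have -> : S (fun u v w => (u == v) && (v == w)) = \sum_(u < n) H u u u.
  apply: eq_bigr => u _.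
  rewrite (bigD1 u) //= [X in _ + X]big1 ?addr0; last first.
    move=> v; rewrite eq_sym => /negbTE uv; rewrite big1 // => w _.
    by rewrite (_ : (u : nat) == v = false).
  rewrite (bigD1 u) //= eqxx [X in _ + X]big1 ?addr0 // => w.
  by rewrite eq_sym => /negbTE uw; rewrite (_ : (u : nat) == w = false).
rewrite /S mulr_natl [in RHS]mulr_natl !mulrSr mulr0n !add0r.
by rewrite !addrA.
Qed.
End Compositions.

Definition sorted_comp (t : nat) (p : 'I_t * 'I_t * 'I_t) : bool :=
  [&& (0 < p.1.1)%N, (p.1.1 < p.1.2)%N, (p.1.2 < p.2)%N & (p.1.1 + p.1.2 + p.2 == t)%N].

(* [(v, i)] indexes the monomial [b (t - 2 v) * b (2 i - t + 1) * b (2 i - t + 1 + 2 v)];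
   the last condition keeps one of the two indices [i], [t - 1 - v - i] giving equal terms. *)
Definition mixed_pair (t : nat) (p : 'I_t * 'I_t) : bool :=
  [&& (0 < p.1)%N, (p.1 + p.2 < t)%N & (t.-1 < p.1 + p.2.*2)%N].

(* [(-1) ^ t * lin_coef t v] is the coefficient of [b (t - 2 v)] arising from compositions
   [v + s + s = t] and from the central terms of the palindromic sums. *)
Definition lin_coef (R : pzRingType) (t v : nat) : R :=
  if odd v == odd t then (if (3 * v == t)%N then 1 else 3) else -1.

(** Once [s = i + 1] is chosen, [w = m - v - i] is forced. The condition on [v] is a multiplicity,
    so that the identity applies to each term of a sum over all [v]. *)
Lemma sum_compositions2 (V : nmodType) (G : nat -> nat -> V) (m v : nat) :
  (v <= m)%N ->
  \sum_(s < m.+1) \sum_(w < m.+1)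
    G s w *+ [&& (0 < s)%N, (0 < w)%N & (v + s + w == m.+1)%N] *+ (0 < v)%N = (\sum_(i < m - v) G i.+1 (m - v - i)%N) *+ (0 < v)%N.
Proof.
case: v => [|v] vm; first by rewrite mulr0n big1 // => s _; rewrite big1.
rewrite mulr1n big_ord_recl [X in X + _]big1 ?add0r; last by move=> w _; rewrite mul0rn.
rewrite (big_ord_widen m (fun i => G i.+1 (m - v.+1 - i)%N)); last by rewrite leq_subr.
rewrite [RHS]big_mkcond; apply: eq_bigr => i _ /=; rewrite /bump /= add1n.
case: ifP => im; last first.
  by rewrite big1 // => w _; rewrite (_ : _ && _ = false) //; have := ltn_ord w; lia.
have wl : (m - v.+1 - i < m.+1)%N by lia.
rewrite (bigD1 (Ordinal wl)) //= big1 ?addr0.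
  by rewrite (_ : _ && _ = true) //; lia.
move=> w /eqP wn; rewrite (_ : _ && _ = false) //; apply/negP => h; apply: wn.
by apply: val_inj => /=; lia.
Qed.

(** * Expansion of the increment into monomials *)

Section Decomposition.
Variables (R : realFieldType) (x : nat -> R).
Hypothesis x2 : forall k, x k * x k = 1.
Local Notation b := (skew_ext x).
Local Notation beta t v := (skew_ext x (t%:Z - v.*2%:Z)).

(** Put [t = m+1]. In [autocor m v] an odd summation index [2i+1] gives the factors
    [b (2i+1-m) = (-1)^t b (t-2(i+1))] and [b (t-2(m-v-i))]. The parts [v], [i+1], [m-v-i] add up to
    [t], hence the compositions. *)
Lemma incr_split m : incr x m.+1 =
  (-1) ^+ m.+1 * (\sum_(u < m.+1) \sum_(v < m.+1) \sum_(w < m.+1)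
     (beta m.+1 u * beta m.+1 v * beta m.+1 w)
        *+ [&& (0 < u)%N, (0 < v)%N, (0 < w)%N & (u + v + w == m.+1)%N]) +
  \sum_(v < m.+1 | (0 < v)%N) beta m.+1 v *
    \sum_(i < (m - v).+1) b (i.*2%:Z - m%:Z) * b (i.*2%:Z - m%:Z + v.*2%:Z).
Proof.
rewrite /incr big_geq_mkord mulr_sumr [X in _ = X + _](_ : _ =
  \sum_(v < m.+1 | (0 < v)%N) beta m.+1 v *
    \sum_(i < m - v) b (i.*2.+1%:Z - m%:Z) * b (i.*2.+1%:Z - m%:Z + v.*2%:Z)).
  rewrite -big_split; apply: eq_bigr => v _ /=.
  by rewrite -mulrDr -(sum_odd_even (fun j => b (j%:Z - m%:Z) * b (j%:Z - m%:Z + v.*2%:Z))).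
rewrite [RHS]big_mkcond; apply: eq_bigr => v _.
have vm : (v <= m)%N by rewrite -ltnS.
rewrite [X in _ * X = _](_ : _ = \sum_(s < m.+1) \sum_(w < m.+1) (beta m.+1 v * (beta m.+1 s * beta m.+1 w)) *+
    [&& (0 < s)%N, (0 < w)%N & (v + s + w == m.+1)%N] *+ (0 < v)%N); last first.
  do 2 (apply: eq_bigr => ? _).
  by rewrite -mulrnA mulrA; congr (_ *+ _); lia.
rewrite (sum_compositions2 (fun s w => beta m.+1 v * (beta m.+1 s * beta m.+1 w))) //.
case: ifP => v0; rewrite ?mulr0n ?mulr0 // mulr1n -mulr_sumr mulrCA; congr (_ * _).
rewrite mulr_sumr; apply: eq_bigr => i _; rewrite mulrA; congr (_ * _); last first.
  by congr b; have := ltn_ord i; lia.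
rewrite (_ : i.*2.+1%:Z - m%:Z = - (m.+1%:Z - i.+1.*2%:Z)) ?skew_extN; last by lia.
by congr (_ * _); rewrite -signr_odd -[RHS]signr_odd; congr (_ ^+ _); lia.
Qed.

(** The composition sum is split by [sum3_symmetric], where a repeated part squares away and leaves
    a linear term. The sum over even indices is a palindrome, which gives the factor 2 and a central
    linear term. *)
Lemma incr_decomp m : incr x m.+1 =
  6 * (-1) ^+ m.+1 * (\sum_(p : 'I_m.+1 * 'I_m.+1 * 'I_m.+1 | sorted_comp p)
     beta m.+1 p.1.1 * beta m.+1 p.1.2 * beta m.+1 p.2) +
  2 * (\sum_(p : 'I_m.+1 * 'I_m.+1 | mixed_pair p) beta m.+1 p.1 *
     (b (p.2.*2%:Z - m%:Z) * b (p.2.*2%:Z - m%:Z + p.1.*2%:Z))) +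
  (-1) ^+ m.+1 * \sum_(v < m.+1 | (0 < v)%N) lin_coef R m.+1 v * beta m.+1 v.
Proof.
rewrite incr_split (@sum3_symmetric R m.+1 (fun u v w => (beta m.+1 u * beta m.+1 v * beta m.+1 w)
        *+ [&& (0 < u)%N, (0 < v)%N, (0 < w)%N & (u + v + w == m.+1)%N])); last 2 first.
- move=> u v w; rewrite [_ * beta _ v]mulrC; congr (_ *+ _); lia.
- move=> u v w; rewrite mulrAC; congr (_ *+ _); lia.
have -> : \sum_(v < m.+1 | (0 < v)%N) beta m.+1 v *
    (\sum_(i < (m - v).+1) b (i.*2%:Z - m%:Z) * b (i.*2%:Z - m%:Z + v.*2%:Z)) =
  (-1) ^+ m.+1 * (\sum_(v < m.+1 | (0 < v)%N)
    (if odd v == odd m.+1 then 0 else -1) * beta m.+1 v) +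
  2 * (\sum_(p : 'I_m.+1 * 'I_m.+1 | mixed_pair p) beta m.+1 p.1 *
     (b (p.2.*2%:Z - m%:Z) * b (p.2.*2%:Z - m%:Z + p.1.*2%:Z))).
  rewrite -(pair_big_dep (fun v : 'I_m.+1 => (0 < v)%N) (fun v i : 'I_m.+1 =>
    (v + i < m.+1)%N && (m < v + i.*2)%N) (fun v i => beta m.+1 v *
    (b (i.*2%:Z - m%:Z) * b (i.*2%:Z - m%:Z + v.*2%:Z)))) /=.
  rewrite !mulr_sumr -big_split; apply: eq_bigr => v v0 /=.
  have vm : (v <= m)%N by rewrite -ltnS.
  rewrite (sum_palindrome (F := fun i => b (i.*2%:Z - m%:Z) * b (i.*2%:Z - m%:Z + v.*2%:Z))); last first.
    move=> i im.
    have -> : (m - v - i).*2%:Z - m%:Z = - (i.*2%:Z - m%:Z + v.*2%:Z) by lia.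
    have -> : - (i.*2%:Z - m%:Z + v.*2%:Z) + v.*2%:Z = - (i.*2%:Z - m%:Z) by lia.
    rewrite !skew_extN.
    have -> : (-1) ^+ absz (i.*2%:Z - m%:Z + v.*2%:Z) = (-1) ^+ absz (i.*2%:Z - m%:Z) :> R.
      by rewrite -signr_odd -[RHS]signr_odd; congr (_ ^+ _); lia.
    by rewrite mulrACA sign_sq mul1r mulrC.
  rewrite mulrDr; congr (_ + _).
    (* The centre [i = (m-v)/2] needs [v] and [m] of equal parity; there the product is
       [b (-v) b v = (-1)^v = -(-1)^(m+1)]. *)
    case: ifP => ov; first by rewrite (_ : odd v == _) ?mul0r ?mulr0 //=; lia.
    rewrite (_ : odd v == _ = false); last by rewrite /=; lia.
    have -> : ((m - v)./2).*2%:Z - m%:Z = - v%:Z by lia.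
    rewrite (_ : - v%:Z + v.*2%:Z = v%:Z) ?skew_extN; last by lia.
    rewrite -mulrA skew_ext_sq // mulr1 mulN1r mulrN -mulNr mulrC; congr (_ * _).
    by rewrite /= -signr_odd -[in RHS]signr_odd -signrN; congr (_ ^+ _); lia.
  rewrite -mulr_sumr [RHS]mulr_natl -mulrnAr; congr (_ * (_ *+ _)).
  rewrite (big_ord_widen_cond m.+1 (fun i => (m - v < i.*2)%N)
    (fun i => b (i.*2%:Z - m%:Z) * b (i.*2%:Z - m%:Z + v.*2%:Z))); last by lia.
  by apply: eq_bigl => i /=; lia.
rewrite addrA [X in _ = X + _]addrC -[RHS]addrA [RHS]addrC; congr (_ + _).
rewrite [6 * (-1) ^+ _]mulrC -[in RHS]mulrA -!mulrDr; congr (_ * _).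
rewrite -!addrA; congr (_ + _).
  congr (_ * _); rewrite pair_bigA pair_bigA [RHS]big_mkcond; apply: eq_bigr => p _ /=.
  rewrite -mulrnA -mulrb; congr (_ *+ _); rewrite /sorted_comp; lia.
(* With [t = m+1], the part repeated next to [u] must be [(t-u)/2], which equals [u] exactly when
   [3u = t]. *)
have -> : \sum_(u < m.+1) \sum_(v < m.+1) beta m.+1 u * beta m.+1 v * beta m.+1 v *+
    [&& (0 < u)%N, (0 < v)%N, (0 < v)%N & (u + v + v == m.+1)%N] *+ (u != v) =
  \sum_(u < m.+1 | (0 < u)%N) ((odd u == odd m.+1) && (3 * u != m.+1)%N)%:R * beta m.+1 u.
  rewrite [RHS]big_mkcond; apply: eq_bigr => u _.
  have ul := ltn_ord u.
  case: ifP => [u0|u0]; last by rewrite big1 // => v _; rewrite mul0rn.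
  rewrite mulr_natl; case: (boolP (_ && _)) => h; last first.
    rewrite big1 // => v _; rewrite -mulrnA (_ : (_ * _)%N = 0%N) //.
    case: (eqVneq u v) => [->|uv]; rewrite ?muln0 //= muln1.
    by move: h uv; rewrite -val_eqE /=; lia.
  have vl : ((m.+1 - u)./2 < m.+1)%N by lia.
  rewrite (bigD1 (Ordinal vl)) //= big1 ?addr0.
    rewrite -mulrA skew_ext_sq // mulr1 -mulrnA mulr1n (_ : (_ * _)%N = 1%N) //.
    rewrite -val_eqE /=; lia.
  move=> v /eqP vn; rewrite -mulrnA (_ : (_ * _)%N = 0%N) //.
  suff : (u + v + v != m.+1)%N by move/negbTE=> ->; rewrite !andbF.
  by apply/negP => e; apply: vn; apply: val_inj => /=; lia.
have -> : \sum_(u < m.+1) beta m.+1 u * beta m.+1 u * beta m.+1 u *+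
    [&& (0 < u)%N, (0 < u)%N, (0 < u)%N & (u + u + u == m.+1)%N] =
  \sum_(u < m.+1 | (0 < u)%N) (3 * u == m.+1)%N%:R * beta m.+1 u.
  rewrite [RHS]big_mkcond; apply: eq_bigr => u _.
  rewrite skew_ext_sq // mul1r mulr_natl; case: ifP => u0 /=; last by [].
  by congr (_ *+ _); lia.
rewrite mulr_sumr -!big_split; apply: eq_bigr => v v0 /=.
rewrite /lin_coef mulrA -!mulrDl; congr (_ * _).
case: (odd v =P odd m.+1) => [_|ov].
  by case: ifP => _ /=; ring.
rewrite /= (_ : (3 * v == m.+1)%N = false); last by apply/negP => e; apply: ov; lia.
by rewrite mulr0 mulr0n !add0r.
Qed.
End Decomposition.

(** * Random signs *)

Section Signs.
Variables (R : realFieldType) (N : nat).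
Local Notation Omega := {ffun 'I_N -> bool}.

Definition rsign (w : Omega) (k : nat) : R :=
  (-1) ^+ (if insub k is Some i then w i else false).

Definition flip (k : nat) (w : Omega) : Omega := [ffun i => w i (+) (i == k :> nat)].

Lemma flipK k : involutive (flip k).
Proof. by move=> w; apply/ffunP => i; rewrite !ffunE addbK. Qed.

Lemma rsign_sq w k : rsign w k * rsign w k = 1.
Proof. exact: sign_sq. Qed.

Lemma rsign_flip w k j :
  rsign (flip k w) j = if (j == k) && (k < N)%N then - rsign w j else rsign w j.
Proof.
rewrite /rsign; case: insubP => [i jN <-|jN]; last first.
  by case: eqP => //= <-; rewrite (negbTE jN).
rewrite ffunE; case: eqP => [<-|_]; last by rewrite addbF.
by rewrite ltn_ord addbT signrN.
Qed.

Lemma sum_flip_odd (k : nat) (G : Omega -> R) :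
  (forall w, G (flip k w) = - G w) -> \sum_w G w = 0.
Proof.
move=> Gk; have : \sum_w G w = - \sum_w G w; last by lra.
by rewrite {1}(reindex_inj (inv_inj (flipK k))) -sumrN; apply: eq_bigr => w _.
Qed.

Definition walsh (w : Omega) (s : seq nat) : R := \prod_(k <- s) rsign w k.

Lemma walsh_sq w s : walsh w s ^+ 2 = 1.
Proof. by rewrite -prodrXl big1 // => k _; rewrite expr2 rsign_sq. Qed.

Lemma walsh_flip w k s : (k < N)%N -> uniq s ->
  walsh (flip k w) s = if k \in s then - walsh w s else walsh w s.
Proof.
move=> kN; elim: s => [|j s IH] /=; first by rewrite /walsh !big_nil.
case/andP => js us; rewrite /walsh !big_cons -!/(walsh _ _) IH // rsign_flip kN andbT inE.
rewrite eq_sym; case: eqP => [->|] /=; last by case: ifP => _ _; rewrite ?mulrN.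
by rewrite (negbTE js) mulNr.
Qed.

(** Some [k] lies in [A] but not in [B], and flipping it negates exactly one factor. Stating this by
    inclusion avoids comparing lists up to order. *)
Lemma walsh_orth (A B : seq nat) : uniq A -> uniq B -> all (fun k => k < N)%N A ->
  ~~ all (mem B) A -> \sum_w walsh w A * walsh w B = 0.
Proof.
move=> uA uB /allP AN /allPn[k kA] /= /negbTE kB; apply: (@sum_flip_odd k) => w.
by rewrite !walsh_flip ?AN // kA kB mulNr.
Qed.

Lemma walsh_parseval (I : finType) (P : pred I) (g : I -> R) (A : I -> seq nat) :
  (forall i, P i -> uniq (A i) && all (fun k => k < N)%N (A i)) ->
  (forall i j, P i -> P j -> all (mem (A j)) (A i) -> i = j) ->
  \sum_w (\sum_(i | P i) g i * walsh w (A i)) ^+ 2 = (2 ^ N)%:R * \sum_(i | P i) g i ^+ 2.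
Proof.
move=> wfA injA; under eq_bigr => w _ do rewrite expr2 mulr_suml.
rewrite exchange_big mulr_sumr; apply: eq_bigr => i Pi /=.
under eq_bigr => w _ do rewrite mulr_sumr.
rewrite exchange_big (bigD1 i) //= [X in _ + X]big1 ?addr0 => [|j /andP[Pj ji]].
  under eq_bigr => w _ do rewrite mulrACA -!expr2 walsh_sq mulr1.
  by rewrite sumr_const card_ffun card_bool card_ord mulr_natl.
under eq_bigr => w _ do rewrite mulrACA.
have /andP[uAi Ai] := wfA _ Pi; have /andP[uAj _] := wfA _ Pj.
rewrite -mulr_sumr walsh_orth ?mulr0 //.
by apply: contra ji => /(injA _ _ Pi Pj)->.
Qed.

Lemma walsh_families_orth (I J : finType) (P : pred I) (Q : pred J) (g : I -> R)
    (h : J -> R) (A : I -> seq nat) (B : J -> seq nat) :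
  (forall i, P i -> uniq (A i) && all (fun k => k < N)%N (A i)) ->
  (forall j, Q j -> uniq (B j)) ->
  (forall i j, P i -> Q j -> ~~ all (mem (B j)) (A i)) ->
  \sum_w (\sum_(i | P i) g i * walsh w (A i)) * (\sum_(j | Q j) h j * walsh w (B j)) = 0.
Proof.
move=> wfA uB AB; under eq_bigr => w _ do rewrite mulr_suml.
rewrite exchange_big big1 // => i Pi.
under eq_bigr => w _ do rewrite mulr_sumr.
rewrite exchange_big big1 // => j Qj.
under eq_bigr => w _ do rewrite mulrACA.
have /andP[uAi Ai] := wfA _ Pi.
by rewrite -mulr_sumr walsh_orth ?mulr0 ?uB ?AB.
Qed.
End Signs.

(** * Mean square of the increment *)

Section IncrementSquare.
Variables (R : realFieldType) (N : nat).
Local Notation Omega := {ffun 'I_N -> bool}.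

Definition skew_sign (z : int) : R := if z is Posz _ then 1 else (-1) ^+ `|z|%N.

Lemma skew_sign_sq z : skew_sign z ^+ 2 = 1.
Proof. by case: z => k; rewrite /skew_sign expr2 ?mulr1 ?sign_sq. Qed.

Lemma skew_extE (x : nat -> R) z : skew_ext x z = skew_sign z * x `|z|%N.
Proof. by case: z => k //=; rewrite mul1r. Qed.

(* [v] and [t - v] yield the same variable, the latter with sign [(-1) ^ t]. *)
Definition fold_coef (t v : nat) : R :=
  if v.*2 == t then lin_coef R t v
  else lin_coef R t v + (-1) ^+ t * lin_coef R t (t - v).

(** The reflection [v -> t - v] carries the terms with [2v > t] to those with [2v < t], up to the
    sign [(-1)^t]. Distinct [v] then carry distinct variables, as Parseval requires. *)
Lemma lin_fold (x : nat -> R) m :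
  \sum_(v < m.+1 | (0 < v)%N) lin_coef R m.+1 v * skew_ext x (m.+1%:Z - v.*2%:Z) =
  \sum_(v < m.+1 | (0 < v)%N && (v.*2 <= m.+1)%N) fold_coef m.+1 v * x (m.+1 - v.*2)%N.
Proof.
set F := fun v => lin_coef R m.+1 v * skew_ext x (m.+1%:Z - v.*2%:Z).
have -> : \sum_(v < m.+1 | (0 < v)%N) F v =
  \sum_(v < m.+1 | (0 < v)%N && (v.*2 <= m.+1)%N) F v +
  \sum_(v < m.+1 | (0 < v)%N && (m.+1 < v.*2)%N) F v.
  rewrite (bigID (fun v : 'I_m.+1 => v.*2 <= m.+1)%N); congr (_ + _).
  by apply: eq_bigl => v; rewrite -ltnNge.
have -> : \sum_(v < m.+1 | (0 < v)%N && (m.+1 < v.*2)%N) F v =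
  \sum_(v < m.+1 | (0 < v)%N && (v.*2 < m.+1)%N) F (m.+1 - v)%N.
  rewrite big_mkcond big_ord_recl /= add0r [RHS]big_mkcond [RHS]big_ord_recl /= add0r.
  rewrite [LHS](reindex_inj rev_ord_inj); apply: eq_bigr => i _.
  rewrite /= /bump !add1n; have il := ltn_ord i.
  rewrite (_ : (m - i.+1).+1 = m.+1 - i.+1)%N; last by lia.
  by rewrite (_ : (m.+1 < _)%N = (i.+1.*2 < m.+1)%N) //; lia.
rewrite [X in _ + X]big_mkcond [X in X + _]big_mkcond [RHS]big_mkcond -big_split.
apply: eq_bigr => v _; have vl := ltn_ord v; rewrite /= /F /fold_coef.
case v0 : (0 < v)%N => /=; last by rewrite addr0.
case: (ltngtP v.*2 m.+1) => vt; rewrite ?addr0 //; last first.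
  by rewrite (_ : m.+1%:Z - v.*2%:Z = Posz (m.+1 - v.*2)%N) //; lia.
rewrite (_ : m.+1%:Z - (m.+1 - v).*2%:Z = - (m.+1%:Z - v.*2%:Z)) ?skew_extN; last by lia.
rewrite (_ : m.+1%:Z - v.*2%:Z = Posz (m.+1 - v.*2)%N) /=; last by lia.
rewrite (_ : (-1) ^+ (m.+1 - v.*2) = (-1) ^+ m.+1 :> R); first by ring.
by rewrite -signr_odd -[RHS]signr_odd; congr (_ ^+ _); lia.
Qed.

Lemma incr_walsh m (w : Omega) : incr (rsign R w) m.+1 =
  (\sum_(p : 'I_m.+1 * 'I_m.+1 * 'I_m.+1 | sorted_comp p)
     6 * (-1) ^+ m.+1 * (skew_sign (m.+1%:Z - p.1.1.*2%:Z) *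
       skew_sign (m.+1%:Z - p.1.2.*2%:Z) * skew_sign (m.+1%:Z - p.2.*2%:Z)) *
     walsh R w [:: absz (m.+1%:Z - p.1.1.*2%:Z); absz (m.+1%:Z - p.1.2.*2%:Z);
                   absz (m.+1%:Z - p.2.*2%:Z)]) +
  (\sum_(p : 'I_m.+1 * 'I_m.+1 | mixed_pair p)
     2 * (skew_sign (m.+1%:Z - p.1.*2%:Z) * skew_sign (p.2.*2%:Z - m%:Z) *
       skew_sign (p.2.*2%:Z - m%:Z + p.1.*2%:Z)) *
     walsh R w [:: absz (m.+1%:Z - p.1.*2%:Z); absz (p.2.*2%:Z - m%:Z);
                   absz (p.2.*2%:Z - m%:Z + p.1.*2%:Z)]) +
  \sum_(v < m.+1 | (0 < v)%N && (v.*2 <= m.+1)%N)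
     (-1) ^+ m.+1 * fold_coef m.+1 v * walsh R w [:: (m.+1 - v.*2)%N].
Proof.
rewrite incr_decomp; last exact: rsign_sq.
rewrite lin_fold !mulr_sumr; congr (_ + _ + _); apply: eq_bigr => p _.
- rewrite /walsh !big_cons big_nil !skew_extE; ring.
- rewrite /walsh !big_cons big_nil !skew_extE; ring.
- rewrite /walsh !big_cons big_nil; ring.
Qed.

Lemma absz_centered_eq (t u v : nat) :
  (absz (t%:Z - u.*2%:Z) == absz (t%:Z - v.*2%:Z)) = (u == v) || (u + v == t)%N.
Proof. lia. Qed.

(** The mean of [incr ^+ 2] at [t = m+1]; 36 and 4 are the squares of the coefficients 6 and 2. *)
Definition incr_msq (m : nat) : R :=
  36 * \sum_(p : 'I_m.+1 * 'I_m.+1 * 'I_m.+1 | sorted_comp p) 1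
    + 4 * \sum_(p : 'I_m.+1 * 'I_m.+1 | mixed_pair p) 1
    + \sum_(v < m.+1 | (0 < v)%N && (v.*2 <= m.+1)%N) fold_coef m.+1 v ^+ 2.

(** Parseval handles each family of monomials. The cross sums vanish: a mixed monomial contains
    indices of the parity of [m], a strict one only indices of the parity of [m+1], and a linear one
    has a single index. *)
Lemma sum_incr_sq m : (m < N)%N ->
  \sum_(w : Omega) incr (rsign R w) m.+1 ^+ 2 = (2 ^ N)%:R * incr_msq m.
Proof.
move=> mN; pose t := m.+1%:Z.
pose A3 (p : 'I_m.+1 * 'I_m.+1 * 'I_m.+1) :=
  [:: absz (t - p.1.1.*2%:Z); absz (t - p.1.2.*2%:Z); absz (t - p.2.*2%:Z)].
pose A2 (p : 'I_m.+1 * 'I_m.+1) := [:: absz (t - p.1.*2%:Z); absz (p.2.*2%:Z - m%:Z);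
                   absz (p.2.*2%:Z - m%:Z + p.1.*2%:Z)].
pose A1 (v : 'I_m.+1) := [:: (m.+1 - v.*2)%N].
have wf3 p : sorted_comp p -> uniq (A3 p) && all (fun k => k < N)%N (A3 p).
  by rewrite /sorted_comp /A3 /t /= !inE; lia.
(* The last condition of [mixed_pair] rules out [|2i-m| = |2i-m+2v|]; parity separates the remaining
   index from these two. *)
have wf2 p : mixed_pair p -> uniq (A2 p) && all (fun k => k < N)%N (A2 p).
  by rewrite /mixed_pair /A2 /t /= !inE; lia.
have wf1 (v : 'I_m.+1) : (0 < v)%N && (v.*2 <= m.+1)%N -> uniq (A1 v) && all (fun k => k < N)%N (A1 v).
  by rewrite /A1 /=; lia.
pose g3 (p : 'I_m.+1 * 'I_m.+1 * 'I_m.+1) := 6 * (-1) ^+ m.+1 *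
  (skew_sign (t - p.1.1.*2%:Z) * skew_sign (t - p.1.2.*2%:Z) * skew_sign (t - p.2.*2%:Z)).
pose g2 (p : 'I_m.+1 * 'I_m.+1) := 2 * (skew_sign (t - p.1.*2%:Z) *
  skew_sign (p.2.*2%:Z - m%:Z) * skew_sign (p.2.*2%:Z - m%:Z + p.1.*2%:Z)).
pose g1 (v : 'I_m.+1) := (-1) ^+ m.+1 * fold_coef m.+1 v.
pose F3 (w : Omega) := \sum_(p | sorted_comp p) g3 p * walsh R w (A3 p).
pose F2 (w : Omega) := \sum_(p | mixed_pair p) g2 p * walsh R w (A2 p).
pose F1 (w : Omega) := \sum_(v < m.+1 | (0 < v)%N && (v.*2 <= m.+1)%N) g1 v * walsh R w (A1 v).
have -> : \sum_(w : Omega) incr (rsign R w) m.+1 ^+ 2 =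
  \sum_w F3 w ^+ 2 + \sum_w F2 w ^+ 2 + \sum_w F1 w ^+ 2
  + 2 * \sum_w F2 w * F3 w + 2 * \sum_w F3 w * F1 w + 2 * \sum_w F2 w * F1 w.
  rewrite !mulr_sumr -!big_split; apply: eq_bigr => w _.
  rewrite incr_walsh -/(F3 w) -/(F2 w) -/(F1 w) /=; ring.
rewrite /F3 walsh_parseval //; last first.
  (* If [u] were matched with [u'] through [u + u' = t], then [v + w = u'] and [v' + w' = u]. The
     other parts are then too small to be complementary, so they agree, and [u = u'] follows. *)
  move=> [[u v] w] [[u' v'] w']; rewrite /sorted_comp /A3 /t /= !inE !absz_centered_eq.
  move=> P1 P2 P3.
  have [-> -> ->] : [/\ u = u', v = v' & w = w']; last by [].
  split; apply: val_inj => /=; lia.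
rewrite /F2 walsh_parseval //; last first.
  (* For a pair [(v, i)] the two indices of the parity of [m] are [c + v] and [|c - v|] with
     [c = 2i-m+v > 0], so [c] and [v] are known up to exchange. The index [|t-2v|] and parity
     exclude a proper exchange. *)
  move=> [u v] [u' v']; rewrite /mixed_pair /A2 /t /= !inE => P1 P2 P3.
  have [-> ->] : u = u' /\ v = v'; last by [].
  split; apply: val_inj => /=; lia.
rewrite /F1 walsh_parseval //; last first.
  by move=> u v P1 P2; rewrite /A1 /= inE andbT => P3; apply: val_inj => /=; lia.
rewrite walsh_families_orth //; last 2 first.
- by move=> p /wf3/andP[].
- by move=> p q; rewrite /sorted_comp /mixed_pair /A2 /A3 /t /= !inE; lia.
rewrite walsh_families_orth //; last first.
- by move=> p v; rewrite /sorted_comp /A3 /A1 /t /= !inE; lia.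
rewrite walsh_families_orth //; last first.
- by move=> p v; rewrite /mixed_pair /A2 /A1 /t /= !inE; lia.
have -> : \sum_(p | sorted_comp p) g3 p ^+ 2 =
    36 * \sum_(p : 'I_m.+1 * 'I_m.+1 * 'I_m.+1 | sorted_comp p) 1.
  rewrite mulr_sumr; apply: eq_bigr => p _.
  by rewrite /g3 !exprMn !skew_sign_sq sqrr_sign !mulr1; ring.
have -> : \sum_(p | mixed_pair p) g2 p ^+ 2 =
    4 * \sum_(p : 'I_m.+1 * 'I_m.+1 | mixed_pair p) 1.
  rewrite mulr_sumr; apply: eq_bigr => p _.
  by rewrite /g2 !exprMn !skew_sign_sq !mulr1; ring.
rewrite /incr_msq.
under [\sum_(v < m.+1 | _) g1 _ ^+ 2]eq_bigr => v _ do rewrite /g1 exprMn sqrr_sign mul1r.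
by ring.
Qed.
End IncrementSquare.

(** * Counting *)

Section Counting.
Variable R : realFieldType.

Lemma sum_ord_interval (n a c : nat) : (c <= n)%N ->
  \sum_(i < n | (a <= i < c)%N) 1 = (c - a)%:R :> R.
Proof.
move=> cn; transitivity (\sum_(a <= i < c) (1 : R)); last by rewrite sumr_const_nat.
rewrite (big_nat_widen a c n) // big_geq_mkord.
by apply: eq_bigl => i /=; rewrite andbC.
Qed.

Lemma sum_ord_eq3 m :
  \sum_(v < m.+1) (3 * v == m.+1)%N%:R = (3 %| m.+1)%N%:R :> R.
Proof.
case: (boolP (3 %| m.+1)%N) => [/dvdnP[q mq]|ndv]; last first.
  rewrite big1 // => v _; case: eqP => // e; case/negP: ndv; rewrite -e; exact: dvdn_mulr.
have ql : (q < m.+1)%N by lia.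
rewrite (bigD1 (Ordinal ql)) //= big1 ?addr0; first by rewrite mq mulnC eqxx.
by move=> v; rewrite -val_eqE /= => vq; rewrite (_ : (_ == _) = false) //; lia.
Qed.

(** Apply [sum3_symmetric] to the indicator of compositions of [m+1]: there are ['C(m, 2)] in all,
    and those of shape [(u, v, v)] are indexed by [1 <= v <= m/2], with [u = v] when [3v = m+1]. *)
Lemma card_sorted_comp m :
  6 * \sum_(p : 'I_m.+1 * 'I_m.+1 * 'I_m.+1 | sorted_comp p) 1 =
  'C(m, 2)%:R - 3 * m./2%:R + 2 * (3 %| m.+1)%N%:R :> R.
Proof.
pose H u v w : R := ([&& 0 < u, 0 < v, 0 < w & u + v + w == m.+1])%N%:R.
have H12 u v w : H u v w = H v u w by rewrite /H; congr (_ %:R); lia.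
have H23 u v w : H u v w = H u w v by rewrite /H; congr (_ %:R); lia.
have := @sum3_symmetric R m.+1 H H12 H23.
have -> : \sum_(u < m.+1) \sum_(v < m.+1) \sum_(w < m.+1) H u v w = 'C(m, 2)%:R.
  transitivity (\sum_(u < m.+1) (if (0 < u)%N then (m - u)%:R else 0 : R)).
    apply: eq_bigr => u _; have um : (u <= m)%N by rewrite -ltnS.
    transitivity (\sum_(v < m.+1) \sum_(w < m.+1) (1 : R) *+
        [&& (0 < v)%N, (0 < w)%N & (u + v + w == m.+1)%N] *+ (0 < u)%N).
      by do 2 (apply: eq_bigr => ? _); rewrite -mulrnA /H; congr (_ %:R); lia.
    rewrite (sum_compositions2 (fun _ _ => 1 : R)) // sumr_const card_ord.
    by case: ifP.
  rewrite big_ord_recl /= add0r (reindex_inj rev_ord_inj) /= -(subn0 m) -bin2_sum.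
  rewrite big_mkord subn0 natr_sum; apply: eq_bigr => i _.
  by rewrite /bump /= add1n; congr (_ %:R); have := ltn_ord i; lia.
have -> : \sum_(u < m.+1) \sum_(v < m.+1) H u v v *+ (u != v) =
    m./2%:R - (3 %| m.+1)%N%:R.
  rewrite exchange_big -sum_ord_eq3 (_ : m./2%:R = (m./2.+1 - 1)%:R); last by rewrite subn1.
  rewrite -(@sum_ord_interval m.+1 1 m./2.+1) ?ltnS ?half_leq //; last by lia.
  rewrite [X in X - _]big_mkcond -sumrB; apply: eq_bigr => v _; have vl := ltn_ord v.
  case: ifP => vm; last first.
    rewrite big1 => [|u _]; first by rewrite (_ : (_ == _) = false) ?subr0 //; lia.
    by rewrite /H -mulrnA (_ : (_ * _)%N = 0%N) //; lia.
  have ul : (m.+1 - v.*2 < m.+1)%N by lia.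
  rewrite (bigD1 (Ordinal ul)) //= big1 ?addr0.
    rewrite /H -val_eqE /= (_ : [&& _, _, _ & _]); last by lia.
    have -> : (m.+1 - v.*2 != v)%N = ~~ (3 * v == m.+1)%N by lia.
    by case: eqP => _; rewrite ?subr0 ?subrr.
  move=> u; rewrite -val_eqE /= => un; rewrite /H -mulrnA (_ : (_ * _)%N = 0%N) //; lia.
have -> : \sum_(u < m.+1) H u u u = (3 %| m.+1)%N%:R.
  by rewrite -sum_ord_eq3; apply: eq_bigr => u _; rewrite /H; congr (_ %:R); lia.
have -> : \sum_(u < m.+1) \sum_(v < m.+1) \sum_(w < m.+1) H u v w *+ (u < v < w)%N =
    \sum_(p : 'I_m.+1 * 'I_m.+1 * 'I_m.+1 | sorted_comp p) 1.
  rewrite pair_bigA pair_bigA [RHS]big_mkcond; apply: eq_bigr => p _ /=.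
  rewrite /H -mulrnA -mulrb; congr (_ %:R); rewrite /sorted_comp; lia.
lra.
Qed.

(** For [v = m - k] the conditions read [k < 2i <= 2k], which leaves [uphalf k] values of [i]. *)
Lemma card_mixed_pair m :
  \sum_(p : 'I_m.+1 * 'I_m.+1 | mixed_pair p) 1 = \sum_(k < m) (uphalf k)%:R :> R.
Proof.
rewrite -(pair_big_dep (fun v : 'I_m.+1 => (0 < v)%N) (fun v i : 'I_m.+1 =>
    (v + i < m.+1)%N && (m < v + i.*2)%N) (fun v i => 1 : R)) /=.
rewrite big_mkcond big_ord_recl /= add0r (reindex_inj rev_ord_inj) /=.
apply: eq_bigr => k _; have km := ltn_ord k.
rewrite /bump add1n (_ : uphalf k = (k.+1 - (k./2).+1)%N); last by lia.
rewrite -(@sum_ord_interval m.+1) //=; last by lia.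
by apply: eq_bigl => i; lia.
Qed.

Lemma sum_uphalf_double k :
  \sum_(j < k.*2) (uphalf j)%:R = k%:R ^+ 2 :> R.
Proof.
elim: k => [|k IH]; first by rewrite big_ord0 expr0n.
rewrite doubleS !big_ord_recr /= IH (_ : uphalf k.*2 = k); last by lia.
by rewrite (_ : k.*2./2 = k) -?natr1; [ring | lia].
Qed.

(** For odd [t] the numbers [v] and [t - v] have opposite parity, so 3 and -1 are subtracted and the
    square is 16. When [3v = t] the 3 becomes 1, and the square drops by 12. *)
Lemma sum_fold_coef_sq_odd k :
  \sum_(v < k.*2.+1 | (0 < v)%N && (v.*2 <= k.*2.+1)%N) fold_coef R k.*2.+1 v ^+ 2 =
  16 * k%:R - 12 * (3 %| k.*2.+1)%N%:R :> R.
Proof.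
transitivity (\sum_(v < k.*2.+1) (16 * ((1 <= v < k.+1)%N%:R : R) - 12 * (3 * v == k.*2.+1)%N%:R)).
  rewrite big_mkcond; apply: eq_bigr => v _; have vl := ltn_ord v.
  case v0 : (0 < v)%N => /=; last first.
    by rewrite (_ : (_ == _) = false) ?mulr0 ?subr0 //; lia.
  have -> : (v.*2 <= k.*2.+1)%N = (v < k.+1)%N by lia.
  case: ltnP => vk; last by rewrite (_ : (_ == _) = false) ?mulr0 ?subr0 //; lia.
  rewrite /fold_coef /lin_coef (_ : v.*2 == _ = false); last by lia.
  rewrite -signr_odd (_ : odd k.*2.+1 = true) ?expr1; last by lia.
  rewrite (_ : odd (k.*2.+1 - v) = ~~ odd v); last by lia.
  case ov : (odd v) => /=; first by case: ifP => _ /=; ring.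
  rewrite (_ : (3 * v == _)%N = false); last by lia.
  rewrite (_ : (3 * (_ - _) == _)%N = false); last by lia.
  by rewrite /=; ring.
rewrite sumrB -!mulr_sumr sum_ord_eq3; congr (_ * _ - _).
transitivity (\sum_(v < k.*2.+1 | (1 <= v < k.+1)%N) 1 : R).
  by rewrite [RHS]big_mkcond; apply: eq_bigr => v _; case: ifP.
by rewrite sum_ord_interval ?subn1 //; lia.
Qed.

(** For even [t] the numbers [v] and [t - v] have equal parity: odd [v < k] give [(-2)^2], even ones
    [6^2], or [4^2] when [3v = t]. The centre [v = k] is unpaired and gives 1 or 9. *)
Lemma sum_fold_coef_sq_even k : (0 < k)%N ->
  \sum_(v < k.*2 | (0 < v)%N && (v.*2 <= k.*2)%N) fold_coef R k.*2 v ^+ 2 =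
  20 * k%:R - 19 - 8 * (2 %| k)%N%:R - 20 * (3 %| k.*2)%N%:R :> R.
Proof.
move=> k0; transitivity (\sum_(v < k.*2) ((if (1 <= v < k.+1)%N then
   (if (v : nat) == k then (if odd k then 1 else 9 : R) else if odd v then 4 else 36) else 0)
   - 20 * (3 * v == k.*2)%N%:R)).
  rewrite big_mkcond; apply: eq_bigr => v _; have vl := ltn_ord v.
  case v0 : (0 < v)%N => /=; last first.
    by rewrite (_ : (_ == _) = false) ?mulr0 ?subr0 //; lia.
  have -> : (v.*2 <= k.*2)%N = (v < k.+1)%N by lia.
  case: ltnP => vk; last by rewrite (_ : (_ == _) = false) ?mulr0 ?subr0 //; lia.
  rewrite /fold_coef /lin_coef (_ : v.*2 == _ = (v == k :> nat)); last by lia.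
  rewrite -signr_odd (_ : odd k.*2 = false) ?expr0; last by lia.
  rewrite (_ : odd (k.*2 - v) = odd v); last by lia.
  rewrite (_ : (3 * (_ - _) == _)%N = false); last by lia.
  case: eqP => [vk'|vk'].
    rewrite (_ : (3 * v == _)%N = false); last by lia.
    by rewrite vk'; case: (odd k) => /=; ring.
  case ov : (odd v) => /=; last by case: ifP => _ /=; ring.
  by rewrite (_ : (3 * v == _)%N = false) /=; [ring | lia].
rewrite sumrB -mulr_sumr -[k.*2]prednK ?double_gt0 // sum_ord_eq3; congr (_ - _).
rewrite prednK ?double_gt0 // -big_mkcond /=.
rewrite -(big_ord_widen_cond k.*2 (fun v => 0 < v)%N (fun v => if v == k then
  if odd k then 1 else 9 else if odd v then 4 else 36 : R)); last by lia.
rewrite big_mkcond big_ord_recr /= k0 eqxx dvdn2.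
have -> : \sum_(i < k) (if (0 < i)%N then if (i : nat) == k then
    if odd k then 1 else 9 else if odd i then 4 else 36 else 0 : R) =
  20 * k%:R - 20 - 16 * (~~ odd k)%:R.
  case: k k0 => // k _; rewrite [LHS](_ : _ = \sum_(i < k) if odd i then 36 else 4).
    elim: k => [|k IH]; first by rewrite big_ord0 /=; ring.
    by rewrite big_ord_recr IH /= -!natr1; case: (odd k) => /=; ring.
  rewrite big_ord_recl /= add0r; apply: eq_bigr => i _.
  rewrite /bump /= add1n (_ : i.+1 == k.+1 = false); first by case: (odd i).
  by have := ltn_ord i; lia.
by case: (odd k) => /=; ring.
Qed.

Lemma natr_doubleS k : k.*2.+1%:R = 2 * k%:R + 1 :> R.
Proof. by rewrite -(natr1 k.*2) -muln2 natrM mulrC. Qed.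

Lemma natr_bin2 n : 'C(n, 2)%:R = n%:R * (n%:R - 1) / 2 :> R.
Proof.
have := congr1 (fun k => k%:R : R) (mul_bin_left n 1).
case: n => [|n]; first by rewrite bin0n /= mul0r mul0r.
rewrite bin1 subn1 /= !natrM -(natr1 n) => E; lra.
Qed.

Lemma incr_msq_odd k : incr_msq R k.*2 = 16 * k%:R ^+ 2 - 8 * k%:R.
Proof.
rewrite /incr_msq card_mixed_pair sum_uphalf_double sum_fold_coef_sq_odd.
have := card_sorted_comp k.*2; rewrite natr_bin2 (_ : k.*2./2 = k); last by lia.
rewrite -muln2 natrM; lra.
Qed.

(** Here [t = 2(k+1)]. Divisibility by 3 adds 12 through the strict compositions and removes 20
    through the linear terms; for odd [t] the two effects, 12 and -12, cancel. *)
Lemma incr_msq_even k : incr_msq R k.*2.+1 =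
  16 * k.+1%:R ^+ 2 - 20 * k.+1%:R + 5 - 8 * (2 %| k.+1)%N%:R - 8 * (3 %| k.+1)%N%:R.
Proof.
rewrite /incr_msq card_mixed_pair big_ord_recr sum_uphalf_double -doubleS sum_fold_coef_sq_even //=.
have := card_sorted_comp k.*2.+1; rewrite natr_bin2.
rewrite -doubleS (_ : k.*2.+1./2 = k); last by lia.
rewrite (_ : (uphalf k.*2 = k)%N); last by lia.
rewrite (_ : (3 %| k.+1.*2) = (3 %| k.+1))%N; last by lia.
rewrite natr_doubleS -(natr1 k).
lra.
Qed.

(** Induction on [m], by parity. Since [64 * 8 = 512], the divisibility terms at even [t] are the
    jumps of the two floors: [2t %/ 8] grows when 4 divides [t], and [2t %/ 12] when 6 does. *)
Lemma sum_incr_msq m : 64 * \sum_(1 <= t < m.+1) incr_msq R t.-1 =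
  32 / 3 * m.*2.+1%:R ^+ 3 - 88 * m.*2.+1%:R ^+ 2 + 592 / 3 * m.*2.+1%:R
      - 512 * (m.*2 %/ 8)%N%:R - 512 * (m.*2 %/ 12)%N%:R - 88
      + 16 * (-1) ^+ m * (m.*2.+1%:R - 3).
Proof.
elim: m => [|m IH]; first by rewrite big_geq // double0 !div0n expr0; lra.
rewrite big_nat_recr //= mulrDr IH.
case om : (odd m); last first.
  have -> : m = (m./2).*2 by lia.
  move: (m./2) => k; rewrite incr_msq_odd.
  rewrite (_ : (k.*2.+1.*2 %/ 8 = k.*2.*2 %/ 8)%N); last by lia.
  rewrite (_ : (k.*2.+1.*2 %/ 12 = k.*2.*2 %/ 12)%N); last by lia.
  rewrite !natr_doubleS -[(-1) ^+ k.*2]signr_odd -[(-1) ^+ k.*2.+1]signr_odd.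
  rewrite /= odd_double expr0 expr1 -(muln2 k) natrM; lra.
have -> : m = (m./2).*2.+1 by lia.
move: (m./2) => k; rewrite incr_msq_even.
rewrite (_ : (k.*2.+2.*2 %/ 8 = k.*2.+1.*2 %/ 8 + (2 %| k.+1))%N); last by lia.
rewrite (_ : (k.*2.+2.*2 %/ 12 = k.*2.+1.*2 %/ 12 + (3 %| k.+1))%N); last by lia.
rewrite !natrD !natr_doubleS -(natr1 k.*2.+1) !natr_doubleS -(natr1 k).
rewrite -[(-1) ^+ k.*2.+1]signr_odd -[(-1) ^+ k.*2.+2]signr_odd /= odd_double expr0 expr1.
lra.
Qed.
End Counting.

(** * Mean and variance over all sign vectors *)

Section Averages.
Variables (R : realFieldType).

Lemma skew_ext_local (x y : nat -> R) z : x `|z|%N = y `|z|%N -> skew_ext x z = skew_ext y z.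
Proof. by case: z => k /= ->. Qed.

Lemma incr_local (x y : nat -> R) t :
  (forall k, (k < t)%N -> x k = y k) -> incr x t = incr y t.
Proof.
case: t => [|m] xy; first by rewrite /incr !big_geq.
apply: eq_big_nat => v /andP[v0 vt]; congr (_ * _).
  by apply: skew_ext_local; apply: xy; lia.
apply: eq_bigr => j _; have jl := ltn_ord j; rewrite /= in jl *.
by congr (_ * _); apply: skew_ext_local; apply: xy; lia.
Qed.

Lemma sum_norm44 m :
  \sum_(w : {ffun 'I_m.+1 -> bool}) norm44 (rsign R w) m =
  (2 ^ m.+1)%:R * (2 * m.*2.+1%:R ^+ 2 - 3 * m.*2.+1%:R + 2).
Proof.
under eq_bigr => w _ do rewrite (norm44_incr (@rsign_sq R _ w)) mulr_sumr.
rewrite big_split /= sumr_const card_ffun card_bool card_ord [RHS]mulr_natl exchange_big.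
rewrite big_nat_cond [X in _ + X]big1 ?addr0 // => t; rewrite andbT => /andP[_ tm].
apply: (@sum_flip_odd _ _ t) => w.
rewrite rsign_flip eqxx tm /= mulNr mulrN; congr (- (_ * (_ * _))).
by apply: incr_local => k kt; rewrite rsign_flip (ltn_eqF kt).
Qed.

(** For [s < t], flipping [x_t] negates the summand at [t] and fixes the one at [s], because [incr]
    at [t] involves only earlier signs. Only the squares survive, and there [x_t] squares away. *)
Lemma sum_norm44_var m :
  \sum_(w : {ffun 'I_m.+1 -> bool})
    (norm44 (rsign R w) m - (2 * m.*2.+1%:R ^+ 2 - 3 * m.*2.+1%:R + 2)) ^+ 2 =
  (2 ^ m.+1)%:R * (64 * \sum_(1 <= t < m.+1) incr_msq R t.-1).
Proof.
set e := _ + 2; pose Z (w : {ffun 'I_m.+1 -> bool}) t := rsign R w t * incr (rsign R w) t.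
under eq_bigr => w _.
  rewrite (norm44_incr (@rsign_sq R _ w)) -/e [e + _]addrC addrK exprMn expr2 -natrM.
  over.
rewrite -mulr_sumr [in RHS]mulrCA; congr (_ * _).
have Zflip s t w : (s <= t)%N -> (t <= m)%N -> Z (flip t w) s = if s == t then - Z w s else Z w s.
  move=> st tm; rewrite /Z rsign_flip ltnS tm andbT.
  rewrite (_ : incr (rsign R (flip t w)) s = incr (rsign R w) s); first by case: ifP; rewrite ?mulNr.
  by apply: incr_local => k ks; rewrite rsign_flip (ltn_eqF (leq_trans ks st)).
have orth s t : (s < t)%N -> (t <= m)%N -> \sum_w Z w s * Z w t = 0.
  move=> st tm; apply: (@sum_flip_odd _ _ t) => w.
  by rewrite !Zflip ?(ltnW st) // eqxx (ltn_eqF st) mulrN.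
under eq_bigr => w _ do rewrite expr2 mulr_suml.
rewrite exchange_big mulr_sumr; apply: eq_big_nat => t /andP[t0 tm] /=.
under eq_bigr => w _ do rewrite mulr_sumr.
rewrite exchange_big /= (bigD1_seq t) ?iota_uniq ?mem_index_iota ?t0 //=.
rewrite [X in _ + X]big_nat_cond [X in _ + X]big1 ?addr0.
  under eq_bigr => w _ do rewrite mulrACA rsign_sq mul1r -expr2.
  case: t t0 tm => // t _ tm; rewrite sum_incr_sq //; exact: ltnW.
move=> s /andP[/andP[s0 sm] st].
move: st; rewrite neq_ltn => /orP[st|ts]; last exact: (orth t s ts sm).
by under eq_bigr => w _ do rewrite mulrC; exact: (orth s t st tm).
Qed.
End Averages.

Section Autocorrelation.
Variables (R : realFieldType) (x : nat -> R).
Hypothesis x2 : forall k, x k * x k = 1.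
Local Notation a m j := (skew_ext x (j%:Z - m%:Z)).

Lemma norm44_autocor m :
  2 * \sum_(u < m.*2.+1) (\sum_(j < m.*2.+1 - u) a m j * a m (j + u)%N) ^+ 2
    - (\sum_(j < m.*2.+1) a m j ^+ 2) ^+ 2 = norm44 x m.
Proof.
rewrite (sum_odd_even (fun u => (\sum_(j < m.*2.+1 - u) a m j * a m (j + u)%N) ^+ 2)).
rewrite big1 ?add0r; last by move=> v _; rewrite odd_autocor0 // expr0n.
have e v : (v <= m)%N -> \sum_(j < m.*2.+1 - v.*2) a m j * a m (j + v.*2)%N = autocor x m v.
  move=> vm; rewrite /autocor (_ : (m.*2.+1 - v.*2 = (m - v).*2.+1)%N); last by lia.
  by apply: eq_bigr => j _; congr (_ * skew_ext x _); lia.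
have e0 : \sum_(j < m.*2.+1) a m j ^+ 2 = m.*2.+1%:R.
  under eq_bigr => j _ do rewrite expr2 skew_ext_sq //.
  by rewrite sumr_const card_ord.
have a0 : autocor x m 0 = m.*2.+1%:R.
  rewrite -e0 /autocor subn0; apply: eq_bigr => j _.
  by rewrite expr2 (_ : j%:Z - m%:Z + 0.*2%:Z = j%:Z - m%:Z) //; lia.
rewrite big_ord_recl /= e // a0.
rewrite e0 /norm44 big_add1 /= big_mkord.
under eq_bigr => v _ do rewrite /bump add1n e //.
ring.
Qed.
End Autocorrelation.

(** * The fourth power mean of a polynomial on the unit circle *)

Section TrigonometricMean.
Variable R : realType.

(** Continuity is bundled with the value, so that integrability is at hand for sums and
    multiples. *)
Definition has_mean (g : R -> R) (v : R) : Prop :=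
  continuous g /\ \int[@lebesgue_measure R]_(t in `[0, 2 * pi]) g t = 2 * pi * v.

Lemma integrable_period (g : R -> R) : continuous g ->
  (@lebesgue_measure R).-integrable `[0, 2 * pi] (EFin \o g).
Proof.
move=> cg; apply: continuous_compact_integrable; first exact: segment_compact.
exact: continuous_subspaceT.
Qed.

Lemma has_meanD g h v w : has_mean g v -> has_mean h w ->
  has_mean (fun t => g t + h t) (v + w).
Proof.
move=> [cg ig] [ch ih]; split.
  by move=> t; apply: cvgD; [exact: cg | exact: ch].
by rewrite RintegralD ?ig ?ih ?[RHS]mulrDr //; exact: integrable_period.
Qed.

Lemma has_meanZ c g v : has_mean g v -> has_mean (fun t => c * g t) (c * v).
Proof.
move=> [cg ig]; split.
  by move=> t; apply: cvgM; [exact: cvg_cst | exact: cg].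
by rewrite RintegralZl //= ?ig 1?mulrCA //; exact: integrable_period.
Qed.

Lemma has_mean_sum (I : Type) (r : seq I) (g : I -> R -> R) (v : I -> R) :
  (forall i, has_mean (g i) (v i)) ->
  has_mean (fun t => \sum_(i <- r) g i t) (\sum_(i <- r) v i).
Proof.
move=> gv; elim: r => [|i r IH].
  rewrite big_nil (_ : (fun _ => _) = cst 0); last by apply/funext => t; rewrite big_nil.
  split; first by move=> t; exact: cvg_cst.
  by rewrite Rintegral_cst ?mul0r ?mulr0.
rewrite big_cons (_ : (fun _ => _) = fun t => g i t + \sum_(j <- r) g j t).
  exact: has_meanD.
by apply/funext => t; rewrite big_cons.
Qed.

Lemma sin_nat2pi k : sin (k%:R * (2 * pi)) = 0 :> R.
Proof.
rewrite mulr_natl [2 * pi]mulr_natl.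
elim: k => [|k IH]; first by rewrite mulr0n sin0.
by rewrite mulrSr sinD2pi.
Qed.

Lemma mean_cos k : has_mean (fun t => cos (k%:R * t)) (k == 0)%:R.
Proof.
have cc : continuous (fun t : R => cos (k%:R * t)).
  move=> t; apply: continuous_comp; last exact: continuous_cos.
  by apply: cvgM; [exact: cvg_cst | exact: cvg_id].
split => //; case: k cc => [|k] cc.
  under eq_Rintegral => t _ do rewrite mul0r cos0.
  rewrite Rintegral_cst //= lebesgue_measure_itv /= lte_fin mulr_gt0 ?pi_gt0 //.
  by rewrite -EFinD subr0 /= mul1r mulr1.
rewrite mulr0 /Rintegral.
have dF (t : R) : is_derive t 1 (fun t : R => k.+1%:R^-1 * sin (k.+1%:R * t)) (cos (k.+1%:R * t)).
  have d1 := is_deriveZ k.+1%:R (is_derive_id t (1 : R)).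
  have d2 := is_deriveZ k.+1%:R^-1 (is_derive1_comp (is_derive_sin _) d1).
  by move: d2; rewrite /GRing.scale /= mulr1 mulrCA mulVf ?mulr1 ?pnatr_eq0.
have cF : continuous (fun t : R => k.+1%:R^-1 * sin (k.+1%:R * t)).
    by move=> t; apply: differentiable_continuous; apply/derivable1_diffP; case: (dF t).
rewrite (@continuous_FTC2 _ _ (fun t => k.+1%:R^-1 * sin (k.+1%:R * t))).
- by rewrite -EFinB sin_nat2pi !mulr0 sin0 mulr0 subrr.
- by rewrite mulr_gt0 ?pi_gt0.
- exact: continuous_subspaceT.
- split.
  + by move=> t _; case: (dF t).
  + by apply: cvg_at_right_filter; exact: cF.
  + by apply: cvg_at_left_filter; exact: cF.
- by move=> t _; rewrite derive1E; have [_ ->] := dF t.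
Qed.
End TrigonometricMean.

Section FourthPower.
Variable R : realType.

Lemma mean_cos_cos u w :
  has_mean (fun t : R => cos (u%:R * t) * cos (w%:R * t)) (((u + w == 0)%N%:R + (u == w)%:R) / 2).
Proof.
wlog uw : u w / (w <= u)%N.
  move=> H; case: (leqP w u) => [|/ltnW] uw; first exact: H.
  rewrite addnC [u == w]eq_sym (_ : (fun t => _) = fun t : R => cos (w%:R * t) * cos (u%:R * t)).
    exact: H.
  by apply/funext => t; rewrite mulrC.
have -> : (u == w) = (u - w == 0)%N by lia.
rewrite (_ : (fun t => _) = fun t => 2^-1 * (cos ((u + w)%N%:R * t) + cos ((u - w)%N%:R * t))).
  by rewrite mulrC; apply: has_meanZ; apply: has_meanD; exact: mean_cos.
apply/funext => t; rewrite natrD natrB // mulrDl mulrBl cosD cosB; lra.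
Qed.

(** The cosines are orthogonal with mean square 1/2, except the constant one with mean square 1; the
    second sum corrects for it. *)
Lemma mean_cos_poly_sq n (c : nat -> R) :
  has_mean (fun t => (\sum_(u < n) c u * cos (u%:R * t)) ^+ 2)
    ((\sum_(u < n) c u ^+ 2 + \sum_(u < n) (u == 0 :> nat)%:R * c u ^+ 2) / 2).
Proof.
rewrite (_ : (fun t => _) = fun t => \sum_(u < n) \sum_(w < n)
    (c u * c w) * (cos (u%:R * t) * cos (w%:R * t))); last first.
  apply/funext => t; rewrite expr2 mulr_suml; apply: eq_bigr => u _.
  by rewrite mulr_sumr; apply: eq_bigr => w _; rewrite mulrACA.
rewrite (_ : _ / 2 = \sum_(u < n) \sum_(w < n)
    (c u * c w) * (((u + w == 0)%N%:R + (u == w :> nat)%:R) / 2)).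
  by do 2 (apply: has_mean_sum => ?); apply: has_meanZ; exact: mean_cos_cos.
rewrite -big_split mulr_suml; apply: eq_bigr => u _ /=.
rewrite (bigD1 u) //= eqxx big1 ?addr0.
  by rewrite addn_eq0 andbb mulr1n; case: (u == 0 :> nat) => /=; lra.
move=> w; rewrite -val_eqE /= => wu; rewrite (_ : (u == w :> nat) = false); last by lia.
by rewrite (_ : (u + w == 0)%N = false) ?addr0 ?mul0r ?mulr0 //; lia.
Qed.

Definition shift_cor (n : nat) (a : nat -> R) (u : nat) : R :=
  \sum_(j < n - u) a j * a (j + u)%N.

(** This is [|f|^2 = C_0 + 2 sum_(u>0) C_u cos(ut)]. Appending [a_n] adds [a_(n-u) a_n] to shift
    [u], and the subtraction formula for cosine turns these into the cross terms of the squares. *)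
Lemma trig_poly_sq n (a : nat -> R) t :
  (\sum_(j < n) a j * cos (j%:R * t)) ^+ 2 + (\sum_(j < n) a j * sin (j%:R * t)) ^+ 2 =
  2 * (\sum_(u < n) shift_cor n a u * cos (u%:R * t)) - \sum_(j < n) a j ^+ 2.
Proof.
elim: n => [|n IH]; first by rewrite !big_ord0; ring.
rewrite !big_ord_recr [in RHS]/shift_cor /=.
have -> : \sum_(u < n) (\sum_(j < n.+1 - u) a j * a (j + u)%N) * cos (u%:R * t)
  + (\sum_(j < n.+1 - n) a j * a (j + n)%N) * cos (n%:R * t) =
  \sum_(u < n) shift_cor n a u * cos (u%:R * t) +
  \sum_(j < n.+1) a j * a n * cos ((n - j)%N%:R * t).
  rewrite -(big_ord_recr n (fun u => (\sum_(j < n.+1 - u) a j * a (j + u)%N) * cos (u%:R * t))) /=.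
  rewrite [X in _ = _ + X](reindex_inj rev_ord_inj) /=.
  have -> : \sum_(u < n) shift_cor n a u * cos (u%:R * t) =
      \sum_(u < n.+1) shift_cor n a u * cos (u%:R * t).
    by rewrite big_ord_recr /= [shift_cor n a n]/shift_cor subnn big_ord0 mul0r addr0.
  rewrite -big_split; apply: eq_bigr => u _ /=.
  have un : (u <= n)%N by rewrite -ltnS.
  by rewrite subSS subKn // subSn // big_ord_recr /= subnK // mulrDl.
rewrite big_ord_recr /= subnn mul0r cos0 mulr1.
have -> : \sum_(j < n) a j * a n * cos ((n - j)%N%:R * t) =
  a n * (cos (n%:R * t) * (\sum_(j < n) a j * cos (j%:R * t)) +
         sin (n%:R * t) * (\sum_(j < n) a j * sin (j%:R * t))).
  rewrite !mulr_sumr -big_split mulr_sumr; apply: eq_bigr => j _ /=.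
  by rewrite natrB ?(ltnW (ltn_ord j)) // mulrBl cosB; ring.
have := cos2Dsin2 (n%:R * t).
set x := cos (n%:R * t); set y := sin (n%:R * t) => xy.
have -> : 2 * (\sum_(u < n) shift_cor n a u * cos (u%:R * t) + (a n * (x * (\sum_(j < n) a j * cos (j%:R * t)) +
         y * (\sum_(j < n) a j * sin (j%:R * t))) + a n * a n)) - (\sum_(j < n) a j ^+ 2 + a n ^+ 2) =
  (2 * (\sum_(u < n) shift_cor n a u * cos (u%:R * t)) - \sum_(j < n) a j ^+ 2)
  + 2 * (a n * (x * (\sum_(j < n) a j * cos (j%:R * t)) +
         y * (\sum_(j < n) a j * sin (j%:R * t)))) + a n ^+ 2 * (x ^+ 2 + y ^+ 2).
  by rewrite xy; ring.
rewrite -IH; ring.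
Qed.

Lemma expiX (t : R) j : expi t ^+ j = expi (j%:R * t).
Proof.
elim: j => [|j IH]; first by rewrite expr0 mul0r /expi cos0 sin0.
rewrite exprS IH /expi -natr1 mulrDl mul1r [_ + t]addrC cosD sinD.
by apply/eqP; rewrite eq_complex /= addrC [X in _ && (_ == X)]addrC !eqxx.
Qed.

Lemma modulus_sq_horner n (a : nat -> R) t :
  modulus (\poly_(j < n) (a j)%:C%C).[expi t] ^+ 2 =
  (\sum_(j < n) a j * cos (j%:R * t)) ^+ 2 + (\sum_(j < n) a j * sin (j%:R * t)) ^+ 2.
Proof.
rewrite horner_poly.
have -> : \sum_(i < n) (a i)%:C%C * expi t ^+ i =
  Complex (\sum_(j < n) a j * cos (j%:R * t)) (\sum_(j < n) a j * sin (j%:R * t)).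
  elim: n => [|n IH]; first by rewrite !big_ord0.
  rewrite !big_ord_recr /= IH expiX /expi.
  by apply/eqP; rewrite eq_complex /= !mul0r subr0 addr0 !eqxx.
rewrite /modulus normc_def /= sqr_sqrtr //; apply: addr_ge0; exact: sqr_ge0.
Qed.

Lemma polynorm4_real n (a : nat -> R) :
  polynorm 4 (\poly_(j < n) (a j)%:C%C) ^+ 4 =
  2 * (\sum_(u < n) shift_cor n a u ^+ 2) - (\sum_(j < n) a j ^+ 2) ^+ 2.
Proof.
rewrite /polynorm; set f := \poly_(j < n) _.
(* These weights absorb the separate shift 0 term into one cosine sum; for [n = 0] that term is
   absent from the sum and must be 0. *)
pose k u : R := if u is 0%N then 1 else 2.
have kF (F : nat -> R) : (n = 0%N -> F 0%N = 0) ->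
    2 * (\sum_(u < n) F u) - F 0%N = \sum_(u < n) k u * F u.
  case: n {f} => [|n] F0; first by rewrite !big_ord0 F0 // mulr0 subr0.
  rewrite !big_ord_recl /= mulrDr mulr_sumr; ring.
have C0 : shift_cor n a 0 = \sum_(j < n) a j ^+ 2.
  by rewrite /shift_cor subn0; apply: eq_bigr => j _; rewrite addn0 expr2.
have C00 : n = 0%N -> shift_cor n a 0 = 0 by move=> n0; rewrite /shift_cor n0 big_ord0.
have mf t : modulus f.[expi t] `^ 4 =
    (\sum_(u < n) k u * shift_cor n a u * cos (u%:R * t)) ^+ 2.
  rewrite powR_mulrn; last first.
    by rewrite /modulus; case: (f.[expi t]) => p q; rewrite normc_def /= sqrtr_ge0.
  rewrite (exprM _ 2 2) modulus_sq_horner trig_poly_sq; congr (_ ^+ 2).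
  have := kF (fun u => shift_cor n a u * cos (u%:R * t)).
  rewrite /= mul0r cos0 mulr1 -C0 => -> //.
  by apply: eq_bigr => u _; rewrite mulrA.
under eq_Rintegral => t _ do rewrite mf.
have [_ ->] := mean_cos_poly_sq n (fun u => k u * shift_cor n a u).
have -> : (\sum_(u < n) (k u * shift_cor n a u) ^+ 2 +
    \sum_(u < n) (u == 0 :> nat)%:R * (k u * shift_cor n a u) ^+ 2) / 2 =
  2 * (\sum_(u < n) shift_cor n a u ^+ 2) - (\sum_(j < n) a j ^+ 2) ^+ 2.
  rewrite -C0 (kF (fun u => shift_cor n a u ^+ 2)) => [|n0]; last by rewrite C00 ?expr0n.
  rewrite -big_split mulr_suml; apply: eq_bigr => -[[|u] un] _ /=; lra.
rewrite mulKf; last by rewrite gt_eqF // mulr_gt0 ?pi_gt0.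
rewrite -powR_mulrn ?powR_ge0 // -powRrM mulVf ?pnatr_eq0 // powRr1 // -C0.
rewrite (kF (fun u => shift_cor n a u ^+ 2)) => [|n0]; last by rewrite C00 ?expr0n.
by apply: sumr_ge0 => -[[|u] un] _; rewrite mulr_ge0 ?sqr_ge0 /=.
Qed.
End FourthPower.

(** * Uniform random skew-symmetric polynomials *)

Section UniformExpectation.
Variables (d : measure_display) (T : measurableType d) (R : realType).
Variables (P : probability T R) (V : choiceType) (S : set V) (F : T -> V).
Hypothesis F_unif : uniform_on P S F.

(** The composite of [G] and [F] is a finite combination of indicators of fibres of [F] over [S],
    each of the same probability. *)
Lemma expectation_uniform (G : V -> R) :
  'E_P[fun w => G (F w)]%E =
  ((#|` fset_set S|%fset)%:R^-1 * \sum_(v <- fset_set S) G v)%:E.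
Proof.
have [finS FS Fv] := F_unif.
have mF v : measurable (F @^-1` [set v]).
  have [Sv|Sv] := pselect (S v); first by have [] := Fv v Sv.
  rewrite (_ : _ @^-1` _ = set0) //; apply/seteqP; split => // w /= e.
  by apply: Sv; rewrite -e; exact: FS.
rewrite unlock.
have e w : (G (F w))%:E = (\sum_(v <- fset_set S) (G v)%:E * (\1_(F @^-1` [set v]) w)%:E)%E.
  have FSw : F w \in fset_set S by rewrite in_fset_set // inE; exact: FS.
  rewrite (bigD1_seq (F w)) ?fset_uniq //= indicE mem_set // mule1 big1 ?adde0 // => v vw.
  by rewrite indicE memNset ?mule0 //= => e; move: vw; rewrite e eqxx.
under eq_integral => w _ do rewrite e.
rewrite integral_sum //; last first.
  by move=> v; apply: integrableZl => //; exact: integrable_indic.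
rewrite mulr_sumr -sumEFin [LHS]big_seq [RHS]big_seq; apply: eq_bigr => v vS.
rewrite integralZl //; last exact: integrable_indic.
rewrite integral_indic // setIT.
have /Fv[_ Pv] : S v by move: vS; rewrite in_fset_set // inE.
by rewrite [X in (_ * X)%E]Pv -EFinM mulrC.
Qed.

Lemma variance_uniform (G : V -> R) (e : R) : 'E_P[fun w => G (F w)]%E = e%:E ->
  'V_P[fun w => G (F w)]%E =
  ((#|` fset_set S|%fset)%:R^-1 * \sum_(v <- fset_set S) (G v - e) ^+ 2)%:E.
Proof.
move=> Ge; rewrite -(expectation_uniform (fun v => (G v - e) ^+ 2)).
by rewrite /variance unlock Ge /=; congr expectation; apply/funext => w; rewrite expr2.
Qed.
End UniformExpectation.

(** * Skew-symmetric polynomials parametrised by free signs *)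

Section SkewLittlewood.
Variables (R : realType) (m : nat).
Local Notation Omega := {ffun 'I_m.+1 -> bool}.
Local Notation n := m.*2.+1.

Definition skew_coef (w : Omega) (j : nat) : R := skew_ext (rsign R w) (j%:Z - m%:Z).

Definition skew_poly (w : Omega) : {poly R[i]} := \poly_(j < n) (skew_coef w j)%:C%C.

Lemma rsign_ord (w : Omega) (i : 'I_m.+1) : rsign R w i = (-1) ^+ w i.
Proof. by rewrite /rsign valK. Qed.

Lemma skew_coef_half (w : Omega) (i : 'I_m.+1) : skew_coef w (m + i) = (-1) ^+ w i.
Proof. by rewrite /skew_coef (_ : _ - _ = Posz i) /= ?rsign_ord //; lia. Qed.

(** The coefficients of degrees [m] to [2m] are the free signs themselves. *)
Lemma skew_poly_inj : injective skew_poly.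
Proof.
move=> w w' ww; apply/ffunP => i; have il := ltn_ord i.
have := congr1 (fun p : {poly R[i]} => p`_(m + i)) ww.
rewrite !coef_poly (_ : (m + i < n)%N); last by lia.
rewrite !skew_coef_half => /complexI.
by case: (w i) (w' i) => -[] //=; rewrite ?expr0 ?expr1; lra.
Qed.

Lemma skew_coefN (w : Omega) j : (j <= m.*2)%N ->
  skew_coef w (m.*2 - j) = (-1) ^+ (m + j) * skew_coef w j.
Proof.
move=> jm; rewrite /skew_coef (_ : (m.*2 - j)%:Z - m%:Z = - (j%:Z - m%:Z)) ?skew_extN; last by lia.
by congr (_ * _); rewrite -signr_odd -[RHS]signr_odd; congr (_ ^+ _); lia.
Qed.

(** A nonzero difference would have the roots [1, ..., size (p - q)], more than its degree
    allows. *)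
Lemma poly_eq_nonzero (p q : {poly R[i]}) :
  (forall z, z != 0 -> p.[z] = q.[z]) -> p = q.
Proof.
move=> pq; apply/eqP; rewrite -subr_eq0; apply/negPn/negP => pq0.
have := max_poly_roots pq0 (rs := [seq k.+1%:R | k <- iota 0 (size (p - q))]).
rewrite size_map size_iota ltnn => H; apply: notF; apply: H.
  by apply/allP => _ /mapP[k _ ->]; rewrite rootE hornerD hornerN pq ?subrr // pnatr_eq0.
by rewrite map_inj_uniq ?iota_uniq // => i j /eqP; rewrite eqr_nat => /eqP[].
Qed.

Lemma horner_skew (a : nat -> R[i]) z : z != 0 ->
  (-1) ^+ m * z ^+ m.*2 * (\poly_(j < n) a j).[- z^-1] =
  (\poly_(j < n) ((-1) ^+ (m + j) * a (m.*2 - j)%N)).[z].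
Proof.
move=> z0; rewrite !horner_poly mulr_sumr (reindex_inj rev_ord_inj) /=.
apply: eq_bigr => j _; have jn : (j <= m.*2)%N by rewrite -ltnS.
rewrite subSS [(- z^-1) ^+ _]exprNn exprVn -[in z ^+ m.*2](subnKC jn) [z ^+ (_ + _)]exprD.
rewrite (_ : (-1) ^+ (m + j) = (-1) ^+ m * (-1) ^+ (m.*2 - j) :> R[i]); last first.
  by rewrite -exprD -signr_odd -[RHS]signr_odd; congr (_ ^+ _); lia.
rewrite -[RHS](mulfK (expf_neq0 (m.*2 - j) z0)); ring.
Qed.

(** The functional equation amounts to [a_j = (-1)^(m+j) a_(2m-j)] for all [j <= 2m], so the
    coefficients of degree at least [m] are free and determine the others. *)
Lemma skew_littlewoodE : skew_littlewood R n = range skew_poly.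
Proof.
rewrite /skew_littlewood; apply/seteqP; split => [f [[a [a1 ->]] [_]]|_ [w _ <-]] /=.
  rewrite doubleK => fz.
  have /polyP af : \poly_(j < n) a j = \poly_(j < n) ((-1) ^+ (m + j) * a (m.*2 - j)%N).
    by apply: poly_eq_nonzero => z z0; rewrite -horner_skew // -fz.
  exists [ffun i : 'I_m.+1 => a (m + i)%N == -1] => //.
  have half j : (m <= j <= m.*2)%N ->
      (skew_coef [ffun i : 'I_m.+1 => a (m + i)%N == -1] j)%:C%C = a j.
    move=> /andP[mj jm]; have jl : (j - m < m.+1)%N by lia.
    rewrite -(subnKC mj) (skew_coef_half _ (Ordinal jl)) ffunE /= subnKC //.
    have jn : (j < m.*2.+1)%N by lia.
    case: (a1 j jn) => ->; last by rewrite eqxx expr1 rmorphN1.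
    by rewrite -subr_eq0 opprK -[1 + 1]/(2%:R) pnatr_eq0 expr0.
  apply/polyP => j; rewrite !coef_poly; case: ltnP => // jn.
  have [mj|jm] := leqP m j; first by rewrite half //; lia.
  rewrite -[in LHS](subKn (_ : j <= m.*2)%N); last by lia.
  rewrite skew_coefN; last by lia.
  rewrite rmorphM rmorphXn rmorphN1 /= half; last by lia.
  have := af j; rewrite !coef_poly jn => ->; congr (_ * _).
  by rewrite -[LHS]signr_odd -[RHS]signr_odd; congr (_ ^+ _); lia.
split; [|split].
- exists (fun j => (skew_coef w j)%:C%C); split => // j _.
  have := skew_ext_sq (@rsign_sq R _ w) (j%:Z - m%:Z) => /eqP.
  rewrite -expr2 sqrf_eq1 => /orP[]/eqP e; rewrite /skew_coef e; first by left.
  by right; rewrite rmorphN1.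
- by rewrite /= odd_double.
move=> z z0; rewrite /= doubleK horner_skew // /skew_poly.
congr (_.[z]); apply/polyP => j; rewrite !coef_poly; case: ltnP => // jn.
rewrite skew_coefN; last by lia.
by rewrite rmorphM rmorphXn rmorphN1 signrMK.
Qed.

Lemma perm_skew_littlewood :
  perm_eq (fset_set (skew_littlewood R n)) [seq skew_poly w | w <- enum {: Omega}].
Proof.
apply: uniq_perm; rewrite ?fset_uniq ?(map_inj_uniq skew_poly_inj) ?enum_uniq // => f.
rewrite in_fset_set; last exact: finite_skew_littlewood.
apply/idP/mapP => [|[w _ ->]]; rewrite inE skew_littlewoodE.
  by move=> [w _ <-]; exists w; rewrite ?mem_enum.
by exists w.
Qed.

Lemma card_skew_littlewood : #|` fset_set (skew_littlewood R n)|%fset = (2 ^ m.+1)%N.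
Proof.
rewrite (perm_size perm_skew_littlewood) size_map -cardE.
by rewrite card_ffun card_bool card_ord.
Qed.

Lemma sum_skew_littlewood (G : {poly R[i]} -> R) :
  \sum_(f <- fset_set (skew_littlewood R n)) G f = \sum_(w : Omega) G (skew_poly w).
Proof.
by rewrite (perm_big _ perm_skew_littlewood) big_map big_enum.
Qed.

Lemma polynorm4_skew_poly (w : Omega) : polynorm 4 (skew_poly w) ^+ 4 = norm44 (rsign R w) m.
Proof. by rewrite polynorm4_real -norm44_autocor //; exact: rsign_sq. Qed.
End SkewLittlewood.

Theorem theorem2 (R : realType) (n : nat) (n_gt1 : (1 < n)%N) (n_odd : odd n)
    (d : measure_display) (T : measurableType d) (P : probability T R)
    (f : T -> {poly R[i]}) (f_unif : uniform_on P (skew_littlewood R n) f) :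
  'E_P[fun w => (polynorm 4 (f w) ^+ 4)%R]%E =
     (2 * n%:R ^+ 2 - 3 * n%:R + 2)%:E /\
  'V_P[fun w => (polynorm 4 (f w) ^+ 4)%R]%E =
     (32 / 3 * n%:R ^+ 3 - 88 * n%:R ^+ 2 + 592 / 3 * n%:R
      - 512 * (n.-1 %/ 8)%N%:R - 512 * (n.-1 %/ 12)%N%:R - 88
      + 16 * (-1) ^+ n.-1./2 * (n%:R - 3))%:E.
Proof.
have [m nm] : exists m, n = m.*2.+1 by exists n./2; lia.
rewrite {n n_gt1 n_odd}nm in f_unif *; rewrite /= doubleK.
have pow0 : (2 ^ m.+1)%:R != 0 :> R by rewrite pnatr_eq0 expn_eq0.
have mean : 'E_P[fun w => (polynorm 4 (f w) ^+ 4)%R]%E =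
    (2 * m.*2.+1%:R ^+ 2 - 3 * m.*2.+1%:R + 2)%:E.
  rewrite (expectation_uniform f_unif (fun g => polynorm 4 g ^+ 4)).
  rewrite card_skew_littlewood sum_skew_littlewood.
  under eq_bigr => w _ do rewrite polynorm4_skew_poly.
  by rewrite sum_norm44 mulKf.
split; first exact: mean.
rewrite (variance_uniform f_unif (G := fun g => polynorm 4 g ^+ 4) mean) card_skew_littlewood sum_skew_littlewood.
under eq_bigr => w _ do rewrite polynorm4_skew_poly.
by rewrite sum_norm44_var mulKf // sum_incr_msq.
Qed.
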